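(* Let $(z,z')$ be admissible and $t=zz'$. For every $\zeta\in\mathbb C$, $$\int_{-1}^1\Phi(t+1;\zeta x)\,\sigma^{(zz')}_1(dx)=\Phi(z+1;\zeta)\,\Phi(-z'+1;-\zeta)=\Phi(z'+1;\zeta)\,\Phi(-z+1;-\zeta),$$ where $\Phi(a;\zeta)={}_1F_1(a;2;\zeta)=\sum_{k\ge0}\frac{(a)_k}{(k+1)!\,k!}\zeta^k$.
   Context: $\sigma^{(zz')}_1$ is the first controlling measure of the spectral $z$-measure $P_{zz'}$; equivalently (and this characterizes it) it is the unique measure on $[-1,1]$ with moments $\int x^l\sigma^{(zz')}_1(dx)=\sum_{p+q=l,\ p,q\ge0}\frac{(-1)^q\,t\,(z+1)_p(-z+1)_q(z'+1)_p(-z'+1)_q}{(t)_{p+q+1}(p+q+1)p!q!}$ for $l=0,1,2,\dots$. Admissible parameters: either $z'=\bar z$, $z\notin\mathbb Z$, or $z,z'$ real in a common interval $(m,m+1)$, $m\in\mathbb Z$. $(a)_n=a(a+1)\cdots(a+n-1)$. *)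

(* Defs.v *)
From HB Require Import structures.
From mathcomp Require Import all_boot all_order all_algebra.
From mathcomp Require Import all_classical all_reals all_analysis.
From mathcomp Require Import complex.
Set Implicit Arguments. Unset Strict Implicit. Unset Printing Implicit Defensive.
Import Order.TTheory GRing.Theory Num.Theory.
Local Open Scope ring_scope.
Local Open Scope complex_scope.

Definition poch {C : pzRingType} (a : C) (n : nat) : C :=
  \prod_(i < n) (a + i%:R).

Definition cRe {R : realType} (w : R[i]) : R := complex.Re w.
Definition cIm {R : realType} (w : R[i]) : R := complex.Im w.

Definition cseries_lim {R : realType} (u : nat -> R[i]) : R[i] :=
  complex.Complex
    (limn (fun n : nat => \sum_(0 <= k < n) cRe (u k)))
    (limn (fun n : nat => \sum_(0 <= k < n) cIm (u k))).

Definition Phi {R : realType} (a w : R[i]) : R[i] :=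
  cseries_lim (fun k => poch a k / ((k.+1)`!%:R * (k`!)%:R) * w ^+ k).

Definition cintegral {R : realType}
    (mu : {measure set R -> \bar R}) (D : set R) (f : R -> R[i]) : R[i] :=
  complex.Complex (Rintegral mu D (fun x => cRe (f x)))
                  (Rintegral mu D (fun x => cIm (f x))).

Definition admissible {R : realType} (z z' : R[i]) : Prop :=
  (z' = complex.conjc z /\ forall m : int, z <> m%:~R)
  \/ (cIm z = 0 /\ cIm z' = 0 /\
      exists m : int, m%:~R < cRe z < m%:~R + 1 /\ m%:~R < cRe z' < m%:~R + 1).

Definition sigma1_moment {R : realType} (z z' : R[i]) (l : nat) : R[i] :=
  let t := z * z' in
  \sum_(p < l.+1)
    let q := (l - p)%N in
    (-1) ^+ q * t * poch (z + 1) p * poch (- z + 1) q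
      * poch (z' + 1) p * poch (- z' + 1) q
    / (poch t (p + q).+1 * (p + q).+1%:R * (p`!)%:R * (q`!)%:R).

(* mu is (a) the first controlling measure sigma_1^{(zz')}: a finite
   measure on the real line carried by [-1,1] whose moments are the
   ones above (this characterizes it uniquely). *)
Definition is_sigma1 {R : realType} (z z' : R[i])
    (mu : {measure set R -> \bar R}) : Prop :=
  (mu setT < +oo)%E /\ mu (~` `[-1, 1])%classic = 0%E /\
  forall l : nat, (Rintegral mu `[-1, 1]%classic (fun x => x ^+ l))%:C
                  = sigma1_moment z z' l.

(* Main.v *)
Require Import Defs.
From HB Require Import structures.
From mathcomp Require Import all_boot all_order all_algebra.
From mathcomp Require Import all_classical all_reals all_analysis.
From mathcomp Require Import measurable_realfun complex ring.
Import Order.TTheory GRing.Theory Num.Theory.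
Import numFieldNormedType.Exports.
Local Open Scope ring_scope.
Local Open Scope complex_scope.

(* The measure is finite and lives on [-1, 1], so dominated convergence lets
   one integrate the power series of Phi (t + 1) term by term; on the other
   side the product of two Phi's is a Cauchy product. Comparing coefficients,
   both equalities follow from one identity, whose left-hand side is symmetric
   in z and z':
     sum_(p + q = l) (-1)^q (z+1)_p (z'+1)_p (1-z)_q (1-z')_q / (p! q!)
       = (l+1)!^2 sum_(p + q = l) (-1)^q (z+1)_p (1-z')_q / ((p+1)! p! (q+1)! q!).
   Since z (z+1)_p (-1)^q (1-z)_q = (z-q)_(l+1), it is the discrete Leibniz rule
   for the l-th backward difference of k |-> (z-k)_(l+1) (z'-k)_(l+1). *)

(** * Finite differences of Pochhammer symbols *)

(** Pascal's rule followed by a shift of the index; it is the common induction step of the two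
    expansions of [iter n bdiff] below. *)
Lemma sum_binS {V : zmodType} (G : nat -> nat -> V) (n : nat) :
  \sum_(j < n.+2) G j (n.+1 - j)%N *+ 'C(n.+1, j)
    = \sum_(j < n.+1) (G j (n - j).+1 + G j.+1 (n - j)%N) *+ 'C(n, j).
Proof.
under [RHS]eq_bigr do rewrite mulrnDl.
rewrite big_split big_ord_recl /= bin0.
under eq_bigr do rewrite /bump /= add1n binS subSS mulrnDr.
rewrite big_split addrA /=; congr (_ + _).
rewrite [RHS]big_ord_recl bin0 [X in _ + X]big_ord_recr /= bin_small // mulr0n addr0.
rewrite !subn0; congr (_ + _); apply: eq_bigr => i _; rewrite /bump /= add1n.
by rewrite -subSn ?subSS.
Qed.

(** For a k = f (x - k) this is f y - f (y - 1) at y = x - k: a backward difference in y, although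
    the index k goes up. *)
Definition bdiff {V : zmodType} (a : nat -> V) (k : nat) : V := a k - a k.+1.

Lemma iter_bdiff {C : pzRingType} (a : nat -> C) (n k : nat) :
  iter n bdiff a k = \sum_(j < n.+1) ((-1) ^+ j * a (k + j)%N) *+ 'C(n, j).
Proof.
elim: n k => [|n IH] k; first by rewrite big_ord1 bin0 mul1r addn0.
rewrite (sum_binS (fun j _ => (-1) ^+ j * a (k + j)%N)) /= /bdiff !IH -sumrB.
apply: eq_bigr => j _.
by rewrite addSnnS exprS -!mulrA mulN1r -mulrnBl.
Qed.

(** One step is A_k B_m - A_(k+1) B_(m+1) = A_k (B_m - B_(m+1)) + (A_k - A_(k+1)) B_(m+1). Each
    difference falling on a thus moves b by one, whence the argument k + j. *)
Lemma iter_bdiffM {C : pzRingType} (a b : nat -> C) (n k : nat) :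
  iter n bdiff (fun i => a i * b i) k
    = \sum_(j < n.+1) (iter j bdiff a k * iter (n - j) bdiff b (k + j)%N) *+ 'C(n, j).
Proof.
elim: n k => [|n IH] k; first by rewrite big_ord1 bin0 addn0.
rewrite (sum_binS (fun j i => iter j bdiff a k * iter i bdiff b (k + j)%N)) /=.
rewrite {1}/bdiff !IH -sumrB; apply: eq_bigr => j _.
rewrite -mulrnBl addSn addnS /=; congr (_ *+ _).
by rewrite /bdiff mulrBr mulrBl [RHS]addrA subrK.
Qed.

Lemma pochS {C : pzRingType} (x : C) n : poch x n.+1 = poch x n * (x + n%:R).
Proof. by rewrite /poch big_ord_recr. Qed.

Lemma pochD {C : pzRingType} (x : C) m n :
  poch x (m + n) = poch x m * poch (x + m%:R) n.
Proof.
rewrite /poch big_split_ord; congr (_ * _); apply: eq_bigr => i _.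
by rewrite /= natrD addrA.
Qed.

Lemma pochSl {C : pzRingType} (x : C) n : poch x n.+1 = x * poch (x + 1) n.
Proof.
by rewrite -[n.+1]add1n pochD /poch big_ord1 addr0.
Qed.

(** The signs turn (1-x)_n into (x-1)(x-2)...(x-n); with x in front this is (x-n)_(n+1) read
    backwards. *)
Lemma poch_reflect {C : comPzRingType} (x : C) n :
  (-1) ^+ n * poch (- x + 1) n * x = poch (x - n%:R) n.+1.
Proof.
elim: n => [|n IH]; first by rewrite /poch big_ord0 big_ord1 expr0 !mul1r addr0 subr0.
rewrite [RHS]pochSl -natr1 [x - _ + 1](_ : _ = x - n%:R); last by ring.
by rewrite -IH pochS exprS; ring.
Qed.

(** With y = x - k and m > 0, (y)_m and (y-1)_m share the factor (y)_(m-1), and the remaining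
    factors y + m - 1 and y - 1 differ by m. *)
Lemma bdiff_poch {C : comPzRingType} (x : C) m k :
  bdiff (fun i => poch (x - i%:R) m) k = m%:R * poch (x - k%:R) m.-1.
Proof.
case: m => [|m]; first by rewrite /bdiff /poch !big_ord0 subrr mul0r.
rewrite /bdiff pochS (pochSl (x - _)) /= -natr1.
rewrite [x - (_ + 1) + 1](_ : _ = x - k%:R); last by ring.
by rewrite -natr1; ring.
Qed.

(** For j > m the falling factorial is 0, so the truncation of m - j is harmless. *)
Lemma iter_bdiff_poch {C : comPzRingType} (x : C) m j k :
  iter j bdiff (fun i => poch (x - i%:R) m) k
    = (m ^_ j)%:R * poch (x - k%:R) (m - j).
Proof.
elim: j k => [|j IH] k; first by rewrite mul1r subn0.
rewrite /= {1}/bdiff !IH -mulrBr ffactnSr natrM -mulrA subnS -bdiff_poch.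
by rewrite /bdiff mulrBr.
Qed.

Lemma poch_convolution {F : numFieldType} (z w : F) (l : nat) :
  z != 0 -> w != 0 ->
  \sum_(p < l.+1) (-1) ^+ (l - p) * poch (z + 1) p * poch (- z + 1) (l - p)
      * poch (w + 1) p * poch (- w + 1) (l - p) / (p`!%:R * (l - p)`!%:R)
    = (l.+1)`!%:R ^+ 2 * \sum_(p < l.+1) (poch (z + 1) p / ((p.+1)`!%:R * p`!%:R))
        * ((-1) ^+ (l - p) * poch (- w + 1) (l - p)
             / (((l - p).+1)`!%:R * (l - p)`!%:R)).
Proof.
move=> z0 w0.
have fact0 n : n`!%:R != 0 :> F by rewrite pnatr_eq0 -lt0n fact_gt0.
(* The factor l! makes binomials out of 1 / (p! q!); z and w are the factors that [poch_reflect]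
   requires. *)
apply: (mulfI (mulf_neq0 (mulf_neq0 (fact0 l) z0) w0)).
have bin_div q : (q <= l)%N -> 'C(l, q)%:R = l`!%:R / (q`!%:R * (l - q)`!%:R) :> F.
  by move=> ql; rewrite -(bin_fact ql) !natrM mulfK // mulf_neq0.
have ffact_div m q : (q <= m)%N -> (m ^_ q)%:R = m`!%:R / (m - q)`!%:R :> F.
  by move=> ql; rewrite -(ffact_fact ql) natrM mulfK.
pose a x i : F := poch (x - i%:R) l.+1.
transitivity (iter l bdiff (fun i => a z i * a w i) 0%N).
  rewrite iter_bdiff mulr_sumr (reindex_inj rev_ord_inj) /=.
  apply: eq_bigr => q _; have ql : (q <= l)%N by rewrite -ltnS.
  rewrite subSS subKn // -[X in _ = X]mulr_natr bin_div // add0n /a.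
  (* Cut the product after its q + 1 factors x - q, ..., x. *)
  have a_split (x : F) : poch (x - q%:R) l.+1
      = (-1) ^+ q * poch (- x + 1) q * x * poch (x + 1) (l - q).
    have := pochD (x - q%:R) q.+1 (l - q); rewrite addSn subnKC // => ->.
    by rewrite poch_reflect -nat1r addrA addrAC subrK.
  rewrite !a_split; have := fact0 q; have := fact0 (l - q)%N.
  have : (-1 : F) ^+ q * (-1) ^+ q = 1 by rewrite -expr2 sqrr_sign.
  move: ((-1) ^+ q) => s s2 f1 f2.
  (* The expansion carries three signs, one of its own and one from each reflection, against a
     single one in the goal. *)
  transitivity (s * s * (l`!%:R * z * w *
    (s * poch (z + 1) (l - q) * poch (- z + 1) q *
   poch (w + 1) (l - q) * poch (- w + 1) q / ((l - q)`!%:R * q`!%:R)))).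
    by rewrite s2 mul1r.
  by field; rewrite f1 f2.
(* By Leibniz, q differences leave (z)_(l-q+1) = z (z+1)_(l-q), and the other l - q leave
   (w-q)_(q+1), which reflects to (-1)^q (1-w)_q w. Here q stands for l - p, hence the reversal. *)
rewrite iter_bdiffM !mulr_sumr [RHS](reindex_inj rev_ord_inj) /=.
apply: eq_bigr => q _; have ql : (q <= l)%N by rewrite -ltnS.
rewrite subSS subKn // -[X in X = _]mulr_natr bin_div // !iter_bdiff_poch subr0 add0n.
rewrite !ffact_div ?leqW ?leq_subr // !subSn ?leq_subr // subKn //.
rewrite pochSl -poch_reflect.
have := fact0 q; have := fact0 (l - q)%N; have := fact0 q.+1; have := fact0 (l - q).+1.
by move=> f1 f2 f3 f4; field; rewrite f1 f2 f3 f4.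
Qed.

(** * Cauchy products of finite sums *)

(** The triangle i + j < n is summed by antidiagonals on the left and by rows on the right. *)
Lemma sum_convolution {C : pzRingType} (u v : nat -> C) (n : nat) :
  \sum_(0 <= k < n) \sum_(p < k.+1) u p * v (k - p)%N
    = \sum_(0 <= i < n) u i * \sum_(0 <= j < n - i) v j.
Proof.
elim: n => [|n IH]; first by rewrite !big_geq.
rewrite big_nat_recr //= IH [RHS]big_nat_recr //= subSn // subnn big_nat1.
rewrite big_ord_recr /= subnn addrA; congr (_ + _).
rewrite -(big_mkord xpredT (fun i => u i * v (n - i)%N)) -big_split /=.
apply: eq_big_nat => i /andP[_ i_n]; rewrite subSn ?(ltnW i_n) //.
by rewrite big_nat_recr //= mulrDr.
Qed.

(* Both sides are sums over the index pairs [i, j < n] with [n <= i + j]. *)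
Lemma norm_sum_convolution_le {C : numDomainType} (u v U V : nat -> C) (n : nat) :
  (forall k, `|u k| <= U k) -> (forall k, `|v k| <= V k) ->
  `|(\sum_(0 <= i < n) u i) * (\sum_(0 <= j < n) v j)
     - \sum_(0 <= k < n) \sum_(p < k.+1) u p * v (k - p)%N|
  <= (\sum_(0 <= i < n) U i) * (\sum_(0 <= j < n) V j)
     - \sum_(0 <= k < n) \sum_(p < k.+1) U p * V (k - p)%N.
Proof.
move=> uU vV.
have tail (a b : nat -> C) : (\sum_(0 <= i < n) a i) * (\sum_(0 <= j < n) b j)
     - \sum_(0 <= k < n) \sum_(p < k.+1) a p * b (k - p)%N
   = \sum_(0 <= i < n) a i * \sum_(n - i <= j < n) b j.
  rewrite sum_convolution mulr_suml -sumrB; apply: eq_bigr => i _.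
  rewrite -mulrBr; congr (_ * _).
  by rewrite (big_cat_nat (n := (n - i)%N)) //= ?leq_subr // addrAC subrr add0r.
rewrite !tail; apply: le_trans (ler_norm_sum _ _ _) _; apply: ler_sum => i _.
rewrite normrM ler_pM // (le_trans (ler_norm_sum _ _ _)) //.
by apply: ler_sum.
Qed.

(** * Complex series and the product of two functions [Phi] *)

Section ComplexSeries.
Context {R : realType}.
Implicit Types (u v s : nat -> R[i]) (x y : R[i]).

Lemma cRe_sum u n : cRe (\sum_(0 <= k < n) u k) = \sum_(0 <= k < n) cRe (u k).
Proof. by apply: (big_morph (@cRe R)) => // -[a b] [c d]. Qed.

Lemma cIm_sum u n : cIm (\sum_(0 <= k < n) u k) = \sum_(0 <= k < n) cIm (u k).
Proof. by apply: (big_morph (@cIm R)) => // -[a b] [c d]. Qed.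

Lemma cRe_mulr x (r : R) : cRe (x * r%:C) = cRe x * r.
Proof. by case: x => a b; rewrite /cRe /= mulr0 subr0. Qed.

Lemma cIm_mulr x (r : R) : cIm (x * r%:C) = cIm x * r.
Proof. by case: x => a b; rewrite /cIm /= mulr0 add0r. Qed.

Lemma norm_cRe_le x (r : R) : `|x| <= r%:C -> `|cRe x| <= r.
Proof. by move=> xr; rewrite -lecR (le_trans (normc_ge_Re x)). Qed.

Lemma norm_cIm_le x (r : R) : `|x| <= r%:C -> `|cIm x| <= r.
Proof.
rewrite normc_def lecR; apply: le_trans.
by rewrite -sqrtr_sqr ler_wsqrtr // lerDr sqr_ge0.
Qed.

(** Convergence is taken componentwise to match [cseries_lim]. *)
Definition ccvg s x : Prop :=
  (cRe (s n) @[n --> \oo] --> cRe x)%classic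
  /\ (cIm (s n) @[n --> \oo] --> cIm x)%classic.

Lemma ccvgB s s' x x' : ccvg s x -> ccvg s' x' -> ccvg (fun n => s n - s' n) (x - x').
Proof.
have ReB y y' : cRe (y - y') = cRe y - cRe y' by case: y; case: y'.
have ImB y y' : cIm (y - y') = cIm y - cIm y' by case: y; case: y'.
move=> [sr si] [sr' si']; split.
  by under eq_fun do rewrite ReB; rewrite ReB; exact: cvgB.
by under eq_fun do rewrite ImB; rewrite ImB; exact: cvgB.
Qed.

Lemma ccvgM s s' x x' : ccvg s x -> ccvg s' x' -> ccvg (fun n => s n * s' n) (x * x').
Proof.
have ReM y y' : cRe (y * y') = cRe y * cRe y' - cIm y * cIm y' by case: y; case: y'.
have ImM y y' : cIm (y * y') = cRe y * cIm y' + cIm y * cRe y' by case: y; case: y'.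
move=> [sr si] [sr' si']; split.
  by under eq_fun do rewrite ReM; rewrite ReM; apply: cvgB; exact: cvgM.
by under eq_fun do rewrite ImM; rewrite ImM; apply: cvgD; exact: cvgM.
Qed.

Lemma ccvg_norm0 s (e : nat -> R) :
  (forall n, `|s n| <= (e n)%:C) -> (e n @[n --> \oo] --> (0 : R))%classic -> ccvg s 0.
Proof.
move=> se e0; split; apply/norm_cvg0P.
  apply: (squeeze_cvgr _ (cvg_cst 0) e0); apply: nearW => n.
  by rewrite normr_ge0 norm_cRe_le.
apply: (squeeze_cvgr _ (cvg_cst 0) e0); apply: nearW => n.
by rewrite normr_ge0 norm_cIm_le.
Qed.

Lemma ccvg_cseries_lim u x :
  ccvg (fun n => \sum_(0 <= k < n) u k) x -> cseries_lim u = x.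
Proof.
move=> [ur ui]; rewrite /cseries_lim.
under [X in limn X]eq_fun do rewrite -cRe_sum.
under [X in _ +i* limn X]eq_fun do rewrite -cIm_sum.
by rewrite (cvg_lim _ ur) // (cvg_lim _ ui) //; case: x {ur ui}.
Qed.

(** As [limn] has a default value on divergent sequences, convergence must be established; one real
    majorant serves both components. *)
Lemma cvg_cseries_lim u (U : nat -> R) :
  (forall k, `|u k| <= (U k)%:C) -> cvgn (series U) ->
  ccvg (fun n => \sum_(0 <= k < n) u k) (cseries_lim u).
Proof.
move=> uU cU.
have cf (f : nat -> R) : (forall k, `|f k| <= U k) ->
    cvgn (fun n => \sum_(0 <= k < n) f k).
  move=> fU; apply: normed_cvg; apply: series_le_cvg cU => [k|k|] //=.
  exact: le_trans (normr_ge0 _) (fU k).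
split.
  by under eq_fun do rewrite cRe_sum; apply: cf => k; exact: norm_cRe_le.
by under eq_fun do rewrite cIm_sum; apply: cf => k; exact: norm_cIm_le.
Qed.

(** The binomial theorem divided by k!. It gives the Cauchy square of the exponential majorant in
    closed form. *)
Lemma sum_exp_coeff_convolution (r : R) k :
  \sum_(p < k.+1) exp_coeff r p * exp_coeff r (k - p)%N = exp_coeff (r + r) k.
Proof.
rewrite /exp_coeff /= exprDn mulr_suml; apply: eq_bigr => p _.
have pk : (p <= k)%N by rewrite -ltnS.
have fact0 n : n`!%:R != 0 :> R by rewrite pnatr_eq0 -lt0n fact_gt0.
rewrite -(mulr_natr (_ * _)) -(bin_fact pk) !natrM.
have := fact0 p; have := fact0 (k - p)%N.
have : 'C(k, p)%:R != 0 :> R by rewrite pnatr_eq0 -lt0n bin_gt0.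
by move=> f1 f2 f3; field; rewrite f1 f2 f3.
Qed.

(* The defect of the partial sums is dominated by the same defect for the
   exponential series, which tends to [exp r * exp r - exp (r + r) = 0]. *)
Lemma cseries_limM u v (r : R) :
  (forall k, `|u k| <= (exp_coeff r k)%:C) ->
  (forall k, `|v k| <= (exp_coeff r k)%:C) ->
  cseries_lim u * cseries_lim v
    = cseries_lim (fun k => \sum_(p < k.+1) u p * v (k - p)%N).
Proof.
move=> uU vU; apply/esym/ccvg_cseries_lim.
have cU := @is_cvg_series_exp_coeff R r.
have uv := ccvgM _ _ _ _ (cvg_cseries_lim _ _ uU cU) (cvg_cseries_lim _ _ vU cU).
pose e n := series (exp_coeff r) n * series (exp_coeff r) n
  - series (exp_coeff (r + r)) n.
have e0 : (e n @[n --> \oo] --> (0 : R))%classic.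
  rewrite -(subrr (expR (r + r))) {1}expRD /e.
  by apply: cvgB; [apply: cvgM|]; exact: is_cvg_series_exp_coeff.
pose w n := \sum_(0 <= k < n) \sum_(p < k.+1) u p * v (k - p)%N.
pose AB n := (\sum_(0 <= i < n) u i) * (\sum_(0 <= j < n) v j).
have defect n : `|AB n - w n| <= (e n)%:C.
  apply: le_trans (norm_sum_convolution_le _ _ _ _ n uU vU) _.
  rewrite /e /series /= rmorphB rmorphM !rmorph_sum /=.
  under [X in _ <= _ - X]eq_bigr do
    (rewrite -sum_exp_coeff_convolution rmorph_sum /=;
     under eq_bigr do rewrite rmorphM /=).
  by [].
(* The convolution sums are [AB n] minus the defect [AB n - w n]. *)
have := ccvgB _ _ _ _ uv (ccvg_norm0 _ _ defect e0); rewrite subr0.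
by under eq_fun do rewrite subKr.
Qed.

(** Factor by factor, |a + i| <= (1 + |a|) (i + 1). *)
Lemma norm_poch_div_fact_le {F : numFieldType} (a : F) k :
  `|poch a k| / k`!%:R <= (1 + `|a|) ^+ k.
Proof.
elim: k => [|k IH]; first by rewrite /poch big_ord0 normr1 divr1.
rewrite pochS normrM factS mulnC natrM invfM mulrACA exprSr ler_pM ?divr_ge0 //.
rewrite ler_pdivrMr ?ltr0n // -nat1r (le_trans (ler_normD _ _)) // normr_nat.
rewrite -subr_ge0 (_ : _ - _ = 1 + `|a| * k%:R); last by ring.
by rewrite addr_ge0 // mulr_ge0.
Qed.

(** One of the two factorials absorbs the Pochhammer symbol, and the other one yields the
    exponential coefficient. *)
Lemma norm_Phi_term_le a w (r : R) k :
  (1 + `|a|) * `|w| <= r%:C ->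
  `|poch a k / ((k.+1)`!%:R * (k`!)%:R) * w ^+ k| <= (exp_coeff r k)%:C.
Proof.
move=> awr; rewrite /exp_coeff /= rmorphM rmorphXn /= fmorphV rmorph_nat.
have aw0 : 0 <= (1 + `|a|) * `|w| by rewrite mulr_ge0 // addr_ge0.
rewrite !normrM normfV normrM !normr_nat normrX.
apply: (@le_trans _ _ (((1 + `|a|) * `|w|) ^+ k / k`!%:R)); last first.
  by rewrite ler_pM2r ?invr_gt0 ?ltr0n ?fact_gt0 // lerXn2r // nnegrE // (le_trans aw0).
rewrite exprMn [leRHS]mulrAC ler_wpM2r ?exprn_ge0 //.
rewrite factS natrM !invfM.
rewrite (_ : _ * _ = `|poch a k| / k`!%:R * (k.+1%:R^-1 / k`!%:R)); last by ring.
rewrite ler_pM ?divr_ge0 ?invr_ge0 ?norm_poch_div_fact_le //.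
by rewrite ler_piMl ?invr_ge0 // invf_le1 ?ltr0n // ler1n.
Qed.

Lemma norm_eq_realC x : exists r : R, `|x| = r%:C.
Proof. by rewrite normc_def; eexists. Qed.

Lemma PhiM a b x y :
  Phi a x * Phi b y = cseries_lim (fun k => \sum_(p < k.+1)
    (poch a p / ((p.+1)`!%:R * (p`!)%:R) * x ^+ p)
    * (poch b (k - p)%N / (((k - p).+1)`!%:R * ((k - p)`!)%:R) * y ^+ (k - p)%N)).
Proof.
have [ra raE] := norm_eq_realC a; have [rb rbE] := norm_eq_realC b.
have [rx rxE] := norm_eq_realC x; have [ry ryE] := norm_eq_realC y.
have a0 : 0 <= ra by rewrite -ler0c -raE.
have b0 : 0 <= rb by rewrite -ler0c -rbE.
have x0 : 0 <= rx by rewrite -ler0c -rxE.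
have y0 : 0 <= ry by rewrite -ler0c -ryE.
(* Adding the two nonnegative bounds gives a single radius valid for both factors. *)
apply: (cseries_limM _ _ ((1 + ra) * rx + (1 + rb) * ry)) => k.
  apply: norm_Phi_term_le.
  rewrite raE rxE -(rmorph1 (real_complex R)) -rmorphD -rmorphM /= lecR.
  by rewrite lerDl mulr_ge0 // addr_ge0.
apply: norm_Phi_term_le.
rewrite rbE ryE -(rmorph1 (real_complex R)) -rmorphD -rmorphM /= lecR.
by rewrite lerDr mulr_ge0 // addr_ge0.
Qed.

End ComplexSeries.

(** * Termwise integration over [-1, 1] *)

Section Integration.
Context {R : realType} (mu : {measure set R -> \bar R}).
Hypothesis mu_fin : (mu setT < +oo)%E.

Local Notation D := (`[(-1 : R)%R, (1 : R)%R]%classic).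

Let mD : measurable D. Proof. exact: measurable_itv. Qed.

Let muD : (mu D < +oo)%E.
Proof. by apply: le_lt_trans mu_fin; apply: le_measure; rewrite ?inE. Qed.

Let norm_le1 (x : R) : D x -> `|x| <= 1.
Proof. by rewrite /= in_itv /= ler_norml. Qed.

Lemma integrable_pow (k : nat) :
  mu.-integrable D (EFin \o (fun x : R => x ^+ k)).
Proof.
apply: measurable_bounded_integrable => //.
exists 1; split => // M M1 x /norm_le1 x1.
by rewrite /= normrX (le_trans _ (ltW M1)) // exprn_ile1.
Qed.

Lemma integrable_sum_pow (c : nat -> R) n :
  mu.-integrable D (EFin \o (fun x => \sum_(0 <= k < n) c k * x ^+ k)).
Proof.
rewrite (_ : _ \o _ =
  (fun x => \sum_(0 <= k < n) (c k)%:E * (x ^+ k)%:E)%E); last first.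
  by apply/funext => x /=; rewrite -sumEFin.
by apply: integrable_sum => // k _; apply: integrableZl => //; exact: integrable_pow.
Qed.

Lemma Rintegral_sum_pow (c : nat -> R) n :
  Rintegral mu D (fun x => \sum_(0 <= k < n) c k * x ^+ k)
  = \sum_(0 <= k < n) c k * Rintegral mu D (fun x => x ^+ k).
Proof.
elim: n => [|n IH].
  rewrite big_geq //; under [X in Rintegral _ _ X]eq_fun do rewrite big_geq //.
  by rewrite Rintegral_cst // mul0r.
rewrite big_nat_recr //= -IH -RintegralZl //; last exact: integrable_pow.
rewrite -RintegralD //; last 2 first.
- exact: integrable_sum_pow.
- exact: (integrableZl mD (c n) (integrable_pow n)).
by congr (Rintegral _ _ _); apply/funext => x; rewrite big_nat_recr.
Qed.

(** Since |x ^ k| <= 1 on [-1, 1], all partial sums are bounded by the sum of U, a constant, which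
    is integrable because the measure is finite. *)
Lemma Rintegral_power_series (c U : nat -> R) :
  (forall k, `|c k| <= U k) -> cvgn (series U) ->
  Rintegral mu D (fun x => limn (fun n => \sum_(0 <= k < n) c k * x ^+ k))
  = limn (fun n => \sum_(0 <= k < n) c k * Rintegral mu D (fun x => x ^+ k)).
Proof.
move=> cU cvgU; pose f n (x : R) := \sum_(0 <= k < n) c k * x ^+ k.
have U0 k : 0 <= U k by exact: le_trans (normr_ge0 _) (cU k).
have cxU x k : D x -> `|c k * x ^+ k| <= U k.
  move=> /norm_le1 x1; rewrite normrM normrX (le_trans _ (cU k)) // ler_piMr //.
  exact: exprn_ile1.
have fU n (x : R) : D x -> `|f n x| <= limn (series U).
  move=> Dx; apply: le_trans (ler_norm_sum _ _ _) _.
  apply: (@le_trans _ _ (series U n)); first by apply: ler_sum => k _; exact: cxU.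
  by apply: nondecreasing_cvgn_le => //; exact: nondecreasing_series.
have ff (x : R) : D x -> (f n x @[n --> \oo] --> limn (f ^~ x))%classic.
  move=> Dx; apply: normed_cvg; apply: series_le_cvg cvgU => [k|k|k] //=.
  exact: cxU.
pose F x : R := limn (f ^~ x); pose B := limn (series U).
have ffE (x : R) : D x ->
    (((f n x)%:E @[n --> \oo]) --> (F x)%:E)%classic.
  by move=> Dx; apply: cvg_EFin; [exact: nearW|exact: ff].
have mf n : measurable_fun D (EFin \o f n).
  by have /integrableP[] := integrable_sum_pow c n.
have mF : measurable_fun D (EFin \o F).
  exact: (emeasurable_fun_cvg (fun n => EFin \o f n) _ mf ffE).
have iB : mu.-integrable D (EFin \o cst B).
  apply: measurable_bounded_integrable => //; exists `|B|; split => // M BM x _.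
  exact: ltW.
(* Dominated convergence yields a limit in the extended reals; finiteness lets [fine] carry it to
   the real integrals. *)
have fin_F : (\int[mu]_(x in D) (F x)%:E)%E \is a fin_num.
  apply: integrable_fin_num => //; apply: le_integrable iB => // x Dx.
  rewrite /= lee_fin [leRHS]ger0_norm; last exact: le_trans (fU 0%N x Dx).
  by apply: cvgr_to_le (cvg_norm (ff x Dx)) _; apply: nearW => n; exact: fU.
have := @dominated_cvg _ _ _ mu D mD (fun n => EFin \o f n)
  (EFin \o F) (EFin \o cst B) mf ffE.
rewrite /= -[X in (_ --> X)%classic](fineK fin_F).
move=> /(_ _ iB) H; apply/esym/cvg_lim => //.
under eq_fun do rewrite -Rintegral_sum_pow.
by apply: fine_cvg; apply: H => // n x Dx; rewrite lee_fin fU.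
Qed.

(** As x is real, x ^ k scales both components of a coefficient, so the real and imaginary parts are
    two real power series in x. *)
Lemma cintegral_Phi (a w : R[i]) :
  cintegral mu D (fun x => Phi a (w * x%:C))
  = cseries_lim (fun k => poch a k / ((k.+1)`!%:R * (k`!)%:R) * w ^+ k
      * (Rintegral mu D (fun x => x ^+ k))%:C).
Proof.
have [ra raE] := norm_eq_realC a; have [rw rwE] := norm_eq_realC w.
pose r := (1 + ra) * rw.
pose c k := poch a k / ((k.+1)`!%:R * (k`!)%:R) * w ^+ k.
have cr k : `|c k| <= (exp_coeff r k)%:C.
  apply: norm_Phi_term_le.
  by rewrite raE rwE -(rmorph1 (real_complex R)) -rmorphD -rmorphM.
have cx x k : poch a k / ((k.+1)`!%:R * (k`!)%:R) * (w * x%:C) ^+ k = c k * (x ^+ k)%:C.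
  by rewrite exprMn mulrA rmorphXn.
have cvg_exp := @is_cvg_series_exp_coeff R r.
have re_r k := norm_cRe_le _ _ (cr k); have im_r k := norm_cIm_le _ _ (cr k).
rewrite /cintegral /cseries_lim.
under [in RHS]eq_fun do (under eq_bigr do rewrite cRe_mulr).
under [X in _ +i* limn X]eq_fun do (under eq_bigr do rewrite cIm_mulr).
rewrite -(Rintegral_power_series _ _ re_r cvg_exp).
rewrite -(Rintegral_power_series _ _ im_r cvg_exp).
congr complex.Complex; congr Rintegral; apply/funext => x; rewrite /Phi /cseries_lim.
  apply: (congr1 (fun s : nat -> R => limn s)); apply/funext => n.
  by apply: eq_bigr => k _; rewrite cx cRe_mulr.
apply: (congr1 (fun s : nat -> R => limn s)); apply/funext => n.
by apply: eq_bigr => k _; rewrite cx cIm_mulr.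
Qed.

End Integration.

(** * Moments of the controlling measure and the conclusion *)

(** Either z z' = |z|^2 with z nonzero, or z and z' are real of the same sign, as no interval (m,
    m+1) contains 0. Positivity makes z, z' and every (t+1)_l nonzero. *)
Lemma admissible_gt0 {R : realType} (z z' : R[i]) : admissible z z' -> 0 < z * z'.
Proof.
case=> [[-> z_int]|[z_re [z'_re [m [/andP[mz zm] /andP[mz' z'm]]]]]].
  rewrite lt_neqAle mulcJ_ge0 andbT eq_sym mulf_eq0 conjc_eq0 orbb.
  by apply/eqP => z0; apply: (z_int 0); rewrite z0.
have reE (x : R[i]) : cIm x = 0 -> x = (cRe x)%:C.
  by case: x => a b; rewrite /cIm /= => ->.
rewrite (reE z) // (reE z') // -rmorphM ltcR.
have [m0|m0] := lerP 0 m.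
  have m0' : 0 <= m%:~R :> R by rewrite ler0z.
  by rewrite mulr_gt0 // (le_lt_trans m0').
have m0' : m%:~R + 1 <= 0 :> R by rewrite -[1]/(1%:~R) -intrD lerz0 lezD1.
by rewrite nmulr_rgt0 (lt_le_trans _ m0').
Qed.

(** Since (t)_(l+1) = t (t+1)_l, all dependence on t cancels, leaving 1 / (l+1)!^2 times the
    left-hand side of [poch_convolution]. *)
Lemma sigma1_moment_Phi {R : realType} (z z' : R[i]) (l : nat) : 0 < z * z' ->
  poch (z * z' + 1) l / ((l.+1)`!%:R * (l`!)%:R) * sigma1_moment z z' l
  = \sum_(p < l.+1) (poch (z + 1) p / ((p.+1)`!%:R * p`!%:R))
        * ((-1) ^+ (l - p) * poch (- z' + 1) (l - p)
             / (((l - p).+1)`!%:R * (l - p)`!%:R)).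
Proof.
move=> t_gt0; have := gt_eqF t_gt0.
rewrite mulf_eq0 => /negbT; rewrite negb_or => /andP[z0 z'0].
have fact0 n : n`!%:R != 0 :> R[i] by rewrite pnatr_eq0 -lt0n fact_gt0.
apply: (mulfI (expf_neq0 2 (fact0 l.+1))); rewrite -poch_convolution // /sigma1_moment.
have t0 : z * z' != 0 by rewrite gt_eqF.
have poch0 : poch (z * z' + 1) l != 0.
  rewrite /poch; apply/prodf_neq0 => i _; rewrite gt_eqF //.
  by rewrite ltr_wpDr // ltr_wpDr.
rewrite !mulr_sumr; apply: eq_bigr => p _.
have pl : (p <= l)%N by rewrite -ltnS.
rewrite subnKC // pochSl factS natrM.
have := fact0 p; have := fact0 (l - p)%N; have := fact0 l.
have : l.+1%:R != 0 :> R[i] by rewrite pnatr_eq0.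
move: (l.+1%:R) => L f1 f2 f3 f4.
by field; rewrite f1 f2 f3 f4 poch0 z0 z'0.
Qed.

Lemma sigma1_momentC {R : realType} (z z' : R[i]) (l : nat) :
  sigma1_moment z z' l = sigma1_moment z' z l.
Proof.
rewrite /sigma1_moment /= (mulrC z'); apply: eq_bigr => p _; congr (_ / _).
by ring.
Qed.

(** The argument - zeta of the second factor supplies the sign (-1)^(l-p) of the convolution. *)
Lemma PhiM_moment {R : realType} (z z' zeta : R[i]) : 0 < z * z' ->
  Phi (z + 1) zeta * Phi (- z' + 1) (- zeta)
  = cseries_lim (fun k => poch (z * z' + 1) k / ((k.+1)`!%:R * (k`!)%:R) * zeta ^+ k
      * sigma1_moment z z' k).
Proof.
move=> t_gt0; rewrite PhiM; congr cseries_lim; apply/funext => l.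
rewrite [RHS]mulrAC sigma1_moment_Phi // mulr_suml; apply: eq_bigr => p _.
have -> : zeta ^+ l = zeta ^+ p * zeta ^+ (l - p) by rewrite -exprD subnKC // -ltnS.
by rewrite (exprNn zeta); ring.
Qed.

Theorem theorem5p2 (R : realType) (z z' : R[i])
    (mu : {measure set R -> \bar R}) :
  admissible z z' -> is_sigma1 z z' mu ->
  forall zeta : R[i],
    cintegral mu `[-1, 1]%classic (fun x => Phi (z * z' + 1) (zeta * x%:C))
      = Phi (z + 1) zeta * Phi (- z' + 1) (- zeta)
    /\ Phi (z + 1) zeta * Phi (- z' + 1) (- zeta)
      = Phi (z' + 1) zeta * Phi (- z + 1) (- zeta).
Proof.
move=> /admissible_gt0 t_gt0 [mu_fin [_ moments]] zeta.
(* Both products become moment series, for (z, z') and for the swapped pair. *)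
rewrite !PhiM_moment // 1?mulrC //; split.
  rewrite cintegral_Phi //; congr cseries_lim; apply/funext => k.
  by rewrite moments.
congr cseries_lim; apply/funext => k.
by rewrite sigma1_momentC (mulrC z').
Qed.
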